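(* Each of the following (possibly large-amplitude) isentropic Navier–Stokes layer profiles $w(z)=(\rho,u,v)(z)$, $z\ge0$, with $\rho>0$ and limit $q_\infty=(\rho_\infty,u_\infty,v_\infty)$, $\rho_\infty>0$, $c_\infty=\sqrt{P'(\rho_\infty)}$, is transversal: (a) outflow, Dirichlet conditions, $v_\infty<0$, $v_\infty+c_\infty>0$: boundary condition $(u,v)(0)=(u_0,v_0)$ with $v_0<0$; (here $v\equiv v_\infty=v_0$); (b) outflow, Dirichlet conditions, $v_\infty+c_\infty<0$: boundary condition $(u,v)(0)=(u_0,v_0)$ with $v_0<0$, where every state $v$ in the closed interval between $v_0$ and $v_\infty$ satisfies $$m_\infty-\frac{m_\infty\, c^2(m_\infty/v,m_\infty/v_\infty)}{v\,v_\infty}<0;$$ (c) inflow, Dirichlet conditions, $v_\infty>0$, $v_\infty-c_\infty<0$: boundary condition $(\rho,u,v)(0)=(\rho_0,u_0,v_0)$ with $v_0>0$ (here $u\equiv u_\infty=u_0$ and $\rho_\infty v_\infty=\rho_0v_0$), where every state $v$ in the closed interval between $v_0$ and $v_\infty$ satisfies the inequality displayed in (b).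
   Context: Isentropic compressible Navier–Stokes equations on the half-space $y>0$: density $\rho$, velocities $u$ (tangential, $x$) and $v$ (normal, $y$), smooth pressure $P(\rho)$ with $P'(\rho)>0$, viscosities $\mu>|\eta|\ge0$, $\epsilon:=2\mu+\eta$. Layer profiles are functions of $z=y\ge 0$ satisfying $$(\rho v)'=0,\qquad(\rho uv)'=\mu u'',\qquad(\rho v^2)'+P(\rho)'=\epsilon v'',$$ with $(\rho,u,v)(+\infty)=(\rho_\infty,u_\infty,v_\infty)$. Equivalently, with $m_\infty=\rho_\infty v_\infty$: $\rho v=m_\infty$, $\mu u'=m_\infty(u-u_\infty)$, and $$\epsilon v'=\Big(m_\infty-\frac{m_\infty c^2(\rho,\rho_\infty)}{v\,v_\infty}\Big)(v-v_\infty),\qquad c^2(\rho,\rho_\infty):=\frac{P(\rho)-P(\rho_\infty)}{\rho-\rho_\infty}\ \big(=P'(\rho_\infty)\text{ if }\rho=\rho_\infty\big).$$ Transversality of a profile $w$: let $\mathcal{S}$ be the space of solutions $\dot w=(\dot\rho,\dot u,\dot v)$ of the (second-order) profile equations linearized at $w$ that have finite limits as $z\to+\infty$, $\mathcal{S}_0$ those tending to $0$. Let $\Gamma\dot w=(\dot u,\dot v)(0)$ and $N_b=2$ in the outflow cases, $\Gamma\dot w=(\dot\rho,\dot u,\dot v)(0)$ and $N_b=3$ in the inflow case. The profile is transversal if (i) no nonzero $\dot w\in\mathcal{S}_0$ satisfies $\Gamma\dot w=0$, and (ii) the map $\Gamma:\mathcal{S}\to\mathbb{C}^{N_b}$ has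 rank $N_b$. *)

(* Defs.v *)
From Stdlib Require Import Reals.
From Coquelicot Require Import Coquelicot.

Open Scope R_scope.

(* Functions on the half-line [0,+oo) are represented by total functions on R
   of which only the values at z >= 0 are ever used. *)

(* df is the derivative of f on the closed half-line; at z = 0 this is the
   one-sided (right) derivative, because of the restricted filter. *)
Definition is_derive_half {V : NormedModule R_AbsRing} (f df : R -> V) : Prop :=
  forall z : R, 0 <= z ->
    filterdiff f (within (fun y : R => 0 <= y) (locally z))
      (fun h : R => scal h (df z)).

Definition tends_at_infty {V : NormedModule R_AbsRing} (f : R -> V) (l : V) : Prop :=
  filterlim f (Rbar_locally p_infty) (locally l).

(* Triples (rho, u, v) of functions of z: real-valued for profiles,
   complex-valued for their perturbations. *)
Record layer (T : Type) := Layer { rho : R -> T; vx : R -> T; vy : R -> T }.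
Arguments Layer {T} _ _ _.
Arguments rho {T} _ _.
Arguments vx {T} _ _.
Arguments vy {T} _ _.

Definition smooth_pressure (P : R -> R) : Prop :=
  (forall (n : nat) (r : R), 0 < r -> ex_derive_n P n r) /\
  (forall r : R, 0 < r -> 0 < Derive P r).

Definition sound_speed (P : R -> R) (r : R) : R := sqrt (Derive P r).

Definition c2 (P : R -> R) (r rinf : R) : R :=
  if Req_EM_T r rinf then Derive P rinf else (P r - P rinf) / (r - rinf).

Definition eps_visc (mu eta : R) : R := 2 * mu + eta.

(* (rho v)' = 0, (rho u v)' = mu u'', (rho v^2)' + P(rho)' = eps v''. *)
Definition profile_equations (P : R -> R) (mu eta : R) (w : layer R) : Prop :=
  exists drho du ddu dv ddv dflux dpress : R -> R,
    is_derive_half (rho w) drho /\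
    is_derive_half (vx w) du /\ is_derive_half du ddu /\
    is_derive_half (vy w) dv /\ is_derive_half dv ddv /\
    is_derive_half (fun z => rho w z * vy w z) (fun _ => 0) /\
    is_derive_half (fun z => rho w z * vx w z * vy w z) (fun z => mu * ddu z) /\
    is_derive_half (fun z => rho w z * (vy w z) ^ 2) dflux /\
    is_derive_half (fun z => P (rho w z)) dpress /\
    (forall z : R, 0 <= z -> dflux z + dpress z = eps_visc mu eta * ddv z).

Definition layer_profile (P : R -> R) (mu eta : R) (rinf uinf vinf : R)
    (w : layer R) : Prop :=
  (forall z : R, 0 <= z -> 0 < rho w z) /\
  profile_equations P mu eta w /\
  tends_at_infty (rho w) rinf /\
  tends_at_infty (vx w) uinf /\
  tends_at_infty (vy w) vinf.

(* Left-hand sides are the first variations, in the direction d, of rho v,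
   rho u v, rho v^2 and P(rho) at w. *)
Definition linearized_equations (P : R -> R) (mu eta : R) (w : layer R)
    (d : layer C) : Prop :=
  exists ddrho du ddu dv ddv dflux dpress : R -> C,
    is_derive_half (V := C_R_NormedModule) (rho d) ddrho /\
    is_derive_half (V := C_R_NormedModule) (vx d) du /\
    is_derive_half (V := C_R_NormedModule) du ddu /\
    is_derive_half (V := C_R_NormedModule) (vy d) dv /\
    is_derive_half (V := C_R_NormedModule) dv ddv /\
    is_derive_half (V := C_R_NormedModule)
      (fun z => rho d z * vy w z + rho w z * vy d z)%C
      (fun _ => RtoC 0) /\
    is_derive_half (V := C_R_NormedModule)
      (fun z => rho d z * vx w z * vy w z + rho w z * vx d z * vy w z
                + rho w z * vx w z * vy d z)%C
      (fun z => mu * ddu z)%C /\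
    is_derive_half (V := C_R_NormedModule)
      (fun z => rho d z * RtoC ((vy w z) ^ 2)
                + 2 * rho w z * vy w z * vy d z)%C
      dflux /\
    is_derive_half (V := C_R_NormedModule)
      (fun z => Derive P (rho w z) * rho d z)%C
      dpress /\
    (forall z : R, 0 <= z ->
       (dflux z + dpress z)%C = (eps_visc mu eta * ddv z)%C).

Definition bounded_space (P : R -> R) (mu eta : R) (w : layer R)
    (d : layer C) : Prop :=
  linearized_equations P mu eta w d /\
  exists r u v : C,
    tends_at_infty (V := C_R_NormedModule) (rho d) r /\
    tends_at_infty (V := C_R_NormedModule) (vx d) u /\
    tends_at_infty (V := C_R_NormedModule) (vy d) v.

Definition decaying_space (P : R -> R) (mu eta : R) (w : layer R)
    (d : layer C) : Prop :=
  linearized_equations P mu eta w d /\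
  tends_at_infty (V := C_R_NormedModule) (rho d) (RtoC 0) /\
  tends_at_infty (V := C_R_NormedModule) (vx d) (RtoC 0) /\
  tends_at_infty (V := C_R_NormedModule) (vy d) (RtoC 0).

(* Sums below run over i = 1, ..., n. *)
Definition lin_comb {V : ModuleSpace C_Ring} (n : nat) (a : nat -> C)
    (e : nat -> V) : V :=
  sum_n_m (fun i => scal (a i : C_Ring) (e i)) 1 n.

Definition lin_indep {V : ModuleSpace C_Ring} (n : nat) (e : nat -> V) : Prop :=
  forall a : nat -> C, lin_comb n a e = zero ->
    forall i : nat, (1 <= i <= n)%nat -> a i = RtoC 0.

(* The image under the linear map G of the complex vector space S has
   dimension n, i.e. it has a basis G (d 1), ..., G (d n). *)
Definition has_rank {E : Type} {V : ModuleSpace C_Ring} (S : E -> Prop)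
    (G : E -> V) (n : nat) : Prop :=
  exists d : nat -> E,
    (forall i : nat, (1 <= i <= n)%nat -> S (d i)) /\
    lin_indep n (fun i => G (d i)) /\
    (forall x : E, S x -> exists a : nat -> C,
       G x = lin_comb n a (fun i => G (d i))).

Definition transversal {V : ModuleSpace C_Ring} (G : layer C -> V) (Nb : nat)
    (P : R -> R) (mu eta : R) (w : layer R) : Prop :=
  (forall d : layer C, decaying_space P mu eta w d -> G d = zero ->
     forall z : R, 0 <= z ->
       rho d z = RtoC 0 /\ vx d z = RtoC 0 /\ vy d z = RtoC 0) /\
  has_rank (bounded_space P mu eta w) G Nb.

Definition C2_space : ModuleSpace C_Ring :=
  prod_ModuleSpace C_Ring C_ModuleSpace C_ModuleSpace.
Definition C3_space : ModuleSpace C_Ring :=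
  prod_ModuleSpace C_Ring C2_space C_ModuleSpace.

Definition Gamma_outflow (d : layer C) : C2_space := (vx d 0, vy d 0).
Definition Gamma_inflow (d : layer C) : C3_space := (rho d 0, vx d 0, vy d 0).

Definition transversal_outflow := transversal Gamma_outflow 2.
Definition transversal_inflow := transversal Gamma_inflow 3.

Definition normal_rate (P : R -> R) (rinf vinf v : R) : R :=
  let m := rinf * vinf in
  m - m * c2 P (m / v) (m / vinf) / (v * vinf).

Definition rate_negative_between (P : R -> R) (rinf vinf v0 : R) : Prop :=
  forall v : R, Rmin v0 vinf <= v <= Rmax v0 vinf -> normal_rate P rinf vinf v < 0.

(* Main.v *)
(* Put R, U, V for the profile, m for its constant mass flux R V, and kappa for the
   constant r V + R v of a linearized solution (r, u, v).  The linearized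
   equations integrate once: mu u' = m u + kappa U + const and
   eps v' = (m - P'(R) R / V) v + kappa (V + P'(R) / V) + const, with
   r = (kappa - R v) / V.  For a decaying solution kappa and both constants vanish,
   so the system is triangular and homogeneous, and u(0) = v(0) = 0 forces it
   to be zero.  For the rank, the sign of m - P'(R) R / V at infinity matters: where
   it is negative, the v-equation has bounded solutions with arbitrary v(0) and
   kappa; where it is positive (case (a)), V is constant and constant v suffices.
   Convergence of the profile already fixes the sign near infinity, and that is
   enough. *)
Require Import Defs.
From Stdlib Require Import Reals Lra Lia.
From Coquelicot Require Import Coquelicot.
Open Scope R_scope.

(** * One-sided calculus on the closed half-line *)

(** [filterdiff] demands its estimate at every limit point of the filter, so the restricted filter
    must be shown to have only one. The ball around [x] of radius [|x - z|] would otherwise have to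
    contain [z] itself. *)
Lemma half_filter_lim (z x : R) (hz : 0 <= z) :
  is_filter_lim (T := R_UniformSpace) (within (fun y : R => 0 <= y) (locally z)) x -> x = z.
Proof.
  intros H.
  destruct (Req_dec x z) as [E|N]; [exact E|exfalso].
  assert (Hd : 0 < Rabs (x - z)) by (apply Rabs_pos_lt; lra).
  specialize (H (fun y => Rabs (y - x) < Rabs (x - z))).
  assert (L : locally x (fun y : R => Rabs (y - x) < Rabs (x - z))).
  { exists (mkposreal _ Hd). intros y Hy. exact Hy. }
  specialize (H L). unfold within in H.
  apply locally_singleton in H. specialize (H hz).
  rewrite Rabs_minus_sym in H. lra.
Qed.

Lemma is_derive_half_ext {V : NormedModule R_AbsRing} (f g df dg : R -> V) :
  (forall z, 0 <= z -> f z = g z) -> (forall z, 0 <= z -> df z = dg z) ->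
  is_derive_half f df -> is_derive_half g dg.
Proof.
  intros Hf Hd H z Hz.
  rewrite <- (Hd z Hz).
  apply (filterdiff_ext_loc f); [| |exact (H z Hz)].
  - unfold within. apply filter_forall. exact Hf.
  - intros x Hx. apply half_filter_lim in Hx; subst; auto.
Qed.

Lemma is_derive_half_of_is_derive {V : NormedModule R_AbsRing} (f df : R -> V) :
  (forall z, 0 <= z -> is_derive f z (df z)) -> is_derive_half f df.
Proof.
  intros H z Hz. destruct (H z Hz) as [Hl Hd]. split; [exact Hl|].
  intros x Hx. apply half_filter_lim in Hx; [subst x|exact Hz].
  intros e. apply filter_le_within. apply Hd. intros P HP; exact HP.
Qed.

Lemma is_derive_half_linear {U V : NormedModule R_AbsRing} (p : U -> V) (f df : R -> U) :
  is_linear p -> is_derive_half f df ->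
  is_derive_half (fun z => p (f z)) (fun z => p (df z)).
Proof.
  intros Hp H z Hz.
  apply filterdiff_ext_lin with (fun h => p (scal h (df z))).
  - apply (filterdiff_comp f p); [apply H, Hz|]. apply filterdiff_linear, Hp.
  - intros h. apply (linear_scal p Hp).
Qed.

(** Continuing [f] to the left by its tangent line at 0 turns the one-sided derivative there into a
    two-sided one. The product rule, the chain rule and the mean value theorem for functions on all
    of R then transfer to the half-line. *)
Definition half_extension (f df : R -> R) (z : R) : R :=
  if Rlt_dec z 0 then f 0 + z * df 0 else f z.

Lemma half_extension_eq (f df : R -> R) (z : R) :
  0 <= z -> half_extension f df z = f z.
Proof. intros H; unfold half_extension; destruct (Rlt_dec z 0); [lra|intros; reflexivity]. Qed.

(** Left of 0 the extension is affine with slope [df 0], which is what clamping the argument of [df]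
    produces; right of 0 it agrees locally with [f]. At 0 the hypothesis controls the right side,
    and on the left the remainder vanishes identically. *)
Lemma is_derive_half_extension (f df : R -> R) :
  is_derive_half f df ->
  forall z, is_derive (half_extension f df) z (df (Rmax 0 z)).
Proof.
  intros H z. destruct (Rlt_dec z 0) as [Hz|Hz].
  - rewrite Rmax_left by lra.
    apply is_derive_ext_loc with (fun z => f 0 + z * df 0).
    + exists (mkposreal (-z) ltac:(lra)). intros y Hy.
      change (Rabs (y - z) < - z) in Hy. apply Rabs_def2 in Hy.
      unfold half_extension; destruct (Rlt_dec y 0); [intros; reflexivity|lra].
    + auto_derive; [exact I|ring].
  - apply Rnot_lt_le in Hz. rewrite Rmax_right by lra.
    split; [apply is_linear_scal_l|].
    intros x Hx. apply (is_filter_lim_locally_unique (V := R_NormedModule)) in Hx; subst x.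
    destruct (H z Hz) as [_ Hd]. specialize (Hd z).
    assert (L : is_filter_lim (T := R_UniformSpace) (within (fun y : R => 0 <= y) (locally z)) z).
    { intros P HP. apply filter_le_within; exact HP. }
    specialize (Hd L). intros e. specialize (Hd e).
    unfold within in Hd. rewrite half_extension_eq by exact Hz.
    destruct (Rlt_dec 0 z) as [Hp|Hn].
    + generalize (filter_and _ _ Hd (open_gt 0 z Hp)).
      apply filter_imp. intros y [Hy1 Hy2].
      rewrite half_extension_eq by lra. apply Hy1; lra.
    + assert (z = 0) by lra; subst z. revert Hd.
      apply filter_imp. intros y Hy.
      destruct (Rlt_dec y 0) as [Hy0|Hy0].
      * unfold half_extension at 1. destruct (Rlt_dec y 0); [|lra].
        unfold norm, minus, plus, opp, scal, mult; simpl; unfold abs, mult; simpl.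
        replace (f 0 + y * df 0 + - f 0 + - ((y + - 0) * df 0)) with 0 by ring.
        rewrite Rabs_R0. apply Rmult_le_pos; [apply Rlt_le, cond_pos|apply Rabs_pos].
      * rewrite half_extension_eq by lra. apply Hy; lra.
Qed.

Lemma is_derive_half_const (c : R) : is_derive_half (fun _ : R => c) (fun _ => 0).
Proof. apply is_derive_half_of_is_derive; intros; auto_derive; trivial. Qed.

Lemma is_derive_half_plus (f g df dg : R -> R) :
  is_derive_half f df -> is_derive_half g dg ->
  is_derive_half (fun z => f z + g z) (fun z => df z + dg z).
Proof.
  intros Hf Hg z Hz.
  eapply filterdiff_ext_lin;
    [apply (filterdiff_plus_fct f g); [apply Hf, Hz|apply Hg, Hz]|].
  intros y; symmetry; apply (scal_distr_l y (df z) (dg z)).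
Qed.

Lemma is_derive_half_mult (f g df dg : R -> R) :
  is_derive_half f df -> is_derive_half g dg ->
  is_derive_half (fun z => f z * g z) (fun z => df z * g z + f z * dg z).
Proof.
  intros Hf Hg.
  apply is_derive_half_ext with (fun z => half_extension f df z * half_extension g dg z)
    (fun z => df (Rmax 0 z) * half_extension g dg z + half_extension f df z * dg (Rmax 0 z)).
  - intros z Hz; rewrite !half_extension_eq by exact Hz; reflexivity.
  - intros z Hz; rewrite !half_extension_eq, Rmax_right by exact Hz; reflexivity.
  - apply is_derive_half_of_is_derive; intros z Hz.
    apply (is_derive_mult (half_extension f df) (half_extension g dg) z);
      [apply is_derive_half_extension, Hf|apply is_derive_half_extension, Hg|].
    intros; apply Rmult_comm.
Qed.

Lemma is_derive_half_comp (F dF f df : R -> R) :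
  (forall z, 0 <= z -> is_derive F (f z) (dF (f z))) -> is_derive_half f df ->
  is_derive_half (fun z => F (f z)) (fun z => df z * dF (f z)).
Proof.
  intros HF Hf.
  apply is_derive_half_ext with (fun z => F (half_extension f df z))
    (fun z => df (Rmax 0 z) * dF (half_extension f df z)).
  - intros z Hz; rewrite !half_extension_eq by exact Hz; reflexivity.
  - intros z Hz; rewrite !half_extension_eq, Rmax_right by exact Hz; reflexivity.
  - apply is_derive_half_of_is_derive; intros z Hz.
    apply (is_derive_comp F (half_extension f df) z).
    + rewrite half_extension_eq by exact Hz. apply HF, Hz.
    + apply is_derive_half_extension, Hf.
Qed.

Lemma is_derive_half_inv (f df : R -> R) :
  (forall z, 0 <= z -> f z <> 0) -> is_derive_half f df ->
  is_derive_half (fun z => / f z) (fun z => df z * (- / (f z) ^ 2)).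
Proof.
  intros Hnz Hf. apply (is_derive_half_comp Rinv (fun x => - / x ^ 2)); [|exact Hf].
  intros z Hz. auto_derive; [exact (Hnz z Hz)|]. field. exact (Hnz z Hz).
Qed.

Lemma half_MVT (f df : R -> R) (x y : R) :
  is_derive_half f df -> 0 <= x <= y ->
  exists c, x <= c <= y /\ f y - f x = df c * (y - x).
Proof.
  intros H Hxy.
  destruct (MVT_gen (half_extension f df) x y (fun z => df (Rmax 0 z))) as [c [Hc E]].
  - intros; apply is_derive_half_extension, H.
  - intros; apply continuity_pt_filterlim.
    apply (ex_derive_continuous (half_extension f df)).
    eexists; apply is_derive_half_extension, H.
  - rewrite Rmin_left, Rmax_right in Hc by lra.
    exists c; split; [exact Hc|].
    rewrite !half_extension_eq, Rmax_right in E by lra. exact E.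
Qed.

Lemma half_derive_zero_const (f : R -> R) :
  is_derive_half f (fun _ => 0) -> forall z, 0 <= z -> f z = f 0.
Proof.
  intros H z Hz. destruct (half_MVT _ _ 0 z H) as [c [_ E]]; lra.
Qed.

Lemma half_derive_nonpos (f df : R -> R) (Z z : R) :
  is_derive_half f df -> 0 <= Z <= z -> (forall x, Z <= x -> df x <= 0) -> f z <= f Z.
Proof.
  intros H Hz Hd. destruct (half_MVT _ _ Z z H Hz) as [c [Hc E]].
  assert (df c * (z - Z) <= 0); [|lra].
  specialize (Hd c (proj1 Hc)). nra.
Qed.

(** Clamping the argument with [Rmax 0] gives continuity on the whole line, which is the form that
    the linear equations below require of their coefficients. *)
Lemma half_derive_continuous (f df : R -> R) :
  is_derive_half f df -> forall z, continuous (fun z => f (Rmax 0 z)) z.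
Proof.
  intros H z. apply continuous_ext with (fun z => half_extension f df (Rmax 0 z)).
  { intros x. apply half_extension_eq, Rmax_l. }
  apply (continuous_comp (Rmax 0) (half_extension f df)).
  - apply continuity_pt_filterlim.
    (* The maximum is rewritten with an absolute value, so that its continuity reduces to that of
       [Rabs]. *)
    apply continuity_pt_ext with (fun z => (0 + z + Rabs (0 - z)) / 2).
    { intros t. unfold Rmax; destruct (Rle_dec 0 t);
      [rewrite Rabs_left1 by lra|rewrite Rabs_right by lra]; lra. }
    apply continuity_pt_filterlim.
    apply (continuous_mult (fun t => 0 + t + Rabs (0 - t)) (fun _ => / 2)); [|apply continuous_const].
    apply (continuous_plus (fun t => 0 + t) (fun t => Rabs (0 - t))).
    + apply (continuous_plus (fun _ => 0) (fun t => t)); [apply continuous_const|apply continuous_id].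
    + apply (continuous_comp (fun t => 0 - t) Rabs); [|apply continuous_Rabs].
      apply (continuous_minus (fun _ => 0) (fun t => t)); [apply continuous_const|apply continuous_id].
  - apply (ex_derive_continuous (half_extension f df)).
    eexists; apply is_derive_half_extension, H.
Qed.

(** * Limits at infinity *)

Lemma tends_real (f : R -> R) (l : R) :
  tends_at_infty f l <->
  forall e, 0 < e -> exists Z, 0 <= Z /\ forall z, Z <= z -> Rabs (f z - l) < e.
Proof.
  split.
  - intros H e He.
    destruct (H (fun x => Rabs (x - l) < e)) as [M HM].
    { exists (mkposreal e He). intros y Hy; exact Hy. }
    exists (Rmax 0 (M + 1)). split; [apply Rmax_l|]. intros z Hz. apply HM.
    pose proof (Rmax_r 0 (M + 1)); lra.
  - intros H Q [e He]. destruct (H e (cond_pos e)) as [Z [_ HZ]].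
    exists Z. intros x Hx. apply He. apply HZ. lra.
Qed.

Lemma tends_ext (f g : R -> R) (l : R) :
  (forall z, 0 <= z -> f z = g z) -> tends_at_infty f l -> tends_at_infty g l.
Proof.
  intros E. apply filterlim_ext_loc. exists 0. intros x Hx; apply E; lra.
Qed.

Lemma tends_const (l : R) : tends_at_infty (fun _ : R => l) l.
Proof. apply filterlim_const. Qed.

Lemma tends_unique (f : R -> R) (l l' : R) :
  tends_at_infty f l -> tends_at_infty f l' -> l = l'.
Proof. apply (filterlim_locally_unique (F := Rbar_locally p_infty) (V := R_NormedModule)). Qed.

Lemma tends_plus (f g : R -> R) (l l' : R) :
  tends_at_infty f l -> tends_at_infty g l' -> tends_at_infty (fun z => f z + g z) (l + l').
Proof. intros Hf Hg. eapply filterlim_comp_2; [exact Hf|exact Hg|apply (filterlim_plus l l')]. Qed.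

Lemma tends_mult (f g : R -> R) (l l' : R) :
  tends_at_infty f l -> tends_at_infty g l' -> tends_at_infty (fun z => f z * g z) (l * l').
Proof. intros Hf Hg. eapply filterlim_comp_2; [exact Hf|exact Hg|apply (@filterlim_mult R_AbsRing l l')]. Qed.

Lemma tends_comp {U V : NormedModule R_AbsRing} (F : U -> V) (f : R -> U) (l : U) :
  continuous F l -> tends_at_infty f l -> tends_at_infty (fun z => F (f z)) (F l).
Proof. intros HF Hf. eapply filterlim_comp; [exact Hf|exact HF]. Qed.

Lemma tends_inv (f : R -> R) (l : R) :
  l <> 0 -> tends_at_infty f l -> tends_at_infty (fun z => / f z) (/ l).
Proof.
  intros Hl. apply (tends_comp (U := R_NormedModule) (V := R_NormedModule) Rinv).
  apply (continuous_Rinv l Hl).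
Qed.

Lemma tends_linear {U V : NormedModule R_AbsRing} (p : U -> V) (f : R -> U) (l : U) :
  is_linear p -> tends_at_infty f l -> tends_at_infty (fun z => p (f z)) (p l).
Proof. intros Hp. apply tends_comp, linear_cont, Hp. Qed.

(** Far out, the increment of [f] over a unit interval is small, and by the mean value theorem it is
    a value of [df], which is close to [l'] there. *)
Lemma tends_derive_zero (f df : R -> R) (l l' : R) :
  is_derive_half f df -> tends_at_infty f l -> tends_at_infty df l' -> l' = 0.
Proof.
  intros H Hf Hd. apply cond_eq. intros e He.
  destruct (proj1 (tends_real _ _) Hf (e / 4)) as [Z1 [HZ1 H1]]; [lra|].
  destruct (proj1 (tends_real _ _) Hd (e / 4)) as [Z2 [HZ2 H2]]; [lra|].
  destruct (half_MVT f df (Z1 + Z2) (Z1 + Z2 + 1) H) as [c [Hc E]]; [lra|].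
  pose proof (H1 (Z1 + Z2)) as A1. pose proof (H1 (Z1 + Z2 + 1)) as A2. pose proof (H2 c) as A3.
  specialize (A1 ltac:(lra)). specialize (A2 ltac:(lra)). specialize (A3 ltac:(lra)).
  apply Rabs_def2 in A1. apply Rabs_def2 in A2. apply Rabs_def2 in A3.
  apply Rabs_def1; lra.
Qed.

(** * Scalar linear differential equations and their behaviour at infinity *)

Lemma primitive_of_continuous (a : R -> R) :
  (forall z, continuous a z) -> exists A, A 0 = 0 /\ forall z, is_derive A z (a z).
Proof.
  intros Ha. exists (fun z => RInt a 0 z). split; [exact (RInt_point 0 a)|].
  intros z. apply is_derive_RInt with 0; [|apply Ha].
  apply filter_forall. intros y. apply (RInt_correct a 0 y).
  apply (ex_RInt_continuous (V := R_CompleteNormedModule)). intros; apply Ha.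
Qed.

(** Integrating factor: with [A] a primitive of [a] vanishing at 0, the function [h exp (- A)] has
    derivative zero. *)
Lemma linear_ode_solution (a h : R -> R) :
  (forall z, continuous a z) -> is_derive_half h (fun z => a z * h z) ->
  exists A, (forall z, is_derive A z (a z)) /\ forall z, 0 <= z -> h z = h 0 * exp (A z).
Proof.
  intros Ha Hh. destruct (primitive_of_continuous a Ha) as [A [A0 HA]].
  exists A. split; [exact HA|].
  assert (K : is_derive_half (fun z => h z * exp (- A z)) (fun _ => 0)).
  { assert (HE : is_derive_half (fun z => exp (- A z)) (fun z => - a z * exp (- A z))).
    { apply is_derive_half_of_is_derive. intros z _.
      pose proof (HA z) as HAz. pose proof (is_derive_unique _ _ _ HAz) as U.
      auto_derive; [eexists; exact HAz|]. change (Derive (fun x => A x) z) with (Derive A z). rewrite U. ring. }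
    eapply is_derive_half_ext; [| |exact (is_derive_half_mult _ _ _ _ Hh HE)].
    - intros; reflexivity.
    - intros z Hz; simpl; ring. }
  intros z Hz. pose proof (half_derive_zero_const _ K z Hz) as E. simpl in E.
  rewrite A0, Ropp_0, exp_0, Rmult_1_r, exp_Ropp in E.
  rewrite <- E. field. apply Rgt_not_eq, exp_pos.
Qed.

Lemma linear_ode_zero (a h : R -> R) :
  (forall z, continuous a z) -> is_derive_half h (fun z => a z * h z) -> h 0 = 0 ->
  forall z, 0 <= z -> h z = 0.
Proof.
  intros Ha Hh H0. destruct (linear_ode_solution a h Ha Hh) as [A [_ E]].
  intros z Hz. rewrite E, H0 by exact Hz. ring.
Qed.

(** Once [a] is positive, [A] is nondecreasing, so [|h| = |h 0| exp A] stays above a positive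
    constant unless [h 0 = 0]. This is the source of the rigidity of profiles whose equation is
    unstable at infinity. *)
Lemma growing_ode_zero (a h : R -> R) (l : R) :
  (forall z, continuous a z) -> is_derive_half h (fun z => a z * h z) ->
  tends_at_infty a l -> 0 < l -> tends_at_infty h 0 ->
  forall z, 0 <= z -> h z = 0.
Proof.
  intros Ha Hh Hl Hpos Hlim. apply (linear_ode_zero a h Ha Hh).
  destruct (linear_ode_solution a h Ha Hh) as [A [HA E]].
  (* Tolerance [l] makes [a] positive beyond [Z]. *)
  destruct (proj1 (tends_real _ _) Hl l Hpos) as [Z [HZ H1]].
  destruct (Req_dec (h 0) 0) as [Z0|N]; [exact Z0|exfalso].
  assert (Hk : 0 < Rabs (h 0) * exp (A Z)).
  { apply Rmult_lt_0_compat; [apply Rabs_pos_lt, N|apply exp_pos]. }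
  destruct (proj1 (tends_real _ _) Hlim _ Hk) as [Z' [HZ' H2]].
  specialize (H2 (Z + Z') ltac:(lra)).
  rewrite E, Rminus_0_r, Rabs_mult, (Rabs_right (exp _)) in H2
    by (try lra; apply Rgt_ge, exp_pos).
  apply Rmult_lt_reg_l in H2; [|apply Rabs_pos_lt, N].
  apply exp_lt_inv in H2.
  assert (M : - A (Z + Z') <= - A Z).
  { apply half_derive_nonpos with (f := fun z => - A z) (df := fun z => - a z); [|lra|].
    - apply is_derive_half_of_is_derive. intros z _. apply (is_derive_opp A), HA.
    - intros x Hx. specialize (H1 x Hx). apply Rabs_def2 in H1. lra. }
  lra.
Qed.

(** With [k = - l / 2 > 0], eventually [a <= - k], so [A z + k z] is nonincreasing and [A] goes to
    minus infinity at least linearly. *)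
Lemma exp_primitive_decays (a A : R -> R) (l : R) :
  (forall z, is_derive A z (a z)) -> tends_at_infty a l -> l < 0 ->
  tends_at_infty (fun z => exp (A z)) 0.
Proof.
  intros HA Hl Hneg.
  destruct (proj1 (tends_real _ _) Hl (- l / 2)) as [Z [HZ H1]]; [lra|].
  set (k := - l / 2) in *.
  assert (M : forall z, Z <= z -> A z + k * z <= A Z + k * Z).
  { intros z Hz.
    apply half_derive_nonpos with (f := fun z => A z + k * z) (df := fun z => a z + k); [|lra|].
    - apply is_derive_half_of_is_derive. intros x _.
      apply (is_derive_plus A (fun x => k * x)); [apply HA|auto_derive; [exact I|ring]].
    - intros x Hx. specialize (H1 x Hx). apply Rabs_def2 in H1. unfold k in *; lra. }
  apply tends_real. intros e He.
  (* Beyond this point the linear bound gives [A z <= ln e - 1], hence [exp (A z) < e]. *)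
  exists (Rmax Z ((A Z + k * Z - ln e + 1) / k)). split.
  { pose proof (Rmax_l Z ((A Z + k * Z - ln e + 1) / k)); lra. }
  intros z Hz.
  pose proof (Rmax_l Z ((A Z + k * Z - ln e + 1) / k)).
  pose proof (Rmax_r Z ((A Z + k * Z - ln e + 1) / k)).
  rewrite Rminus_0_r, Rabs_right by apply Rgt_ge, exp_pos.
  rewrite <- (exp_ln e He) at 1. apply exp_increasing.
  specialize (M z ltac:(lra)).
  assert (Hk : 0 < k) by (unfold k; lra).
  assert (A Z + k * Z - ln e + 1 <= k * z); [|lra].
  apply Rmult_le_reg_r with (/ k); [apply Rinv_0_lt_compat, Hk|].
  replace (k * z * / k) with z by (field; lra). unfold Rdiv in *; lra.
Qed.

(* Once [a <= -k] and [|b| <= k e], the function [(y - e) exp (- A)] is nonincreasing. *)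
Lemma stable_ode_upper (a b A y : R -> R) (l : R) :
  (forall z, is_derive A z (a z)) -> tends_at_infty a l -> l < 0 ->
  tends_at_infty b 0 -> (forall z, is_derive y z (a z * y z + b z)) ->
  forall e, 0 < e -> exists Z, 0 <= Z /\ forall z, Z <= z -> y z < e.
Proof.
  intros HA Hl Hneg Hb Hy e He.
  destruct (proj1 (tends_real _ _) Hl (- l / 2)) as [Z1 [HZ1 H1]]; [lra|].
  (* The forcing is made smaller than [k (e / 2)] with [k = - l / 2], so that the term
     [a (e / 2) <= - k (e / 2)] absorbs it. *)
  destruct (proj1 (tends_real _ _) Hb (- l / 2 * (e / 2))) as [Z2 [HZ2 H2]]; [nra|].
  set (Z := Z1 + Z2).
  set (C := Rabs ((y Z - e / 2) * exp (- A Z))).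
  assert (HC : 0 <= C) by apply Rabs_pos.
  (* [C] bounds the value at [Z] of the nonincreasing function; beyond [Z3] its product with
     [exp (A z)] is below [e / 2]. Dividing by [C + 1] keeps the quotient meaningful when
     [C = 0]. *)
  destruct (proj1 (tends_real _ _) (exp_primitive_decays a A l HA Hl Hneg) (e / 2 / (C + 1)))
    as [Z3 [HZ3 H3]]; [apply Rdiv_lt_0_compat; lra|].
  exists (Z + Z3). unfold Z in *; split; [lra|]. intros z Hz.
  assert (M : (y z - e / 2) * exp (- A z) <= (y (Z1 + Z2) - e / 2) * exp (- A (Z1 + Z2))).
  { apply half_derive_nonpos with (f := fun z => (y z - e / 2) * exp (- A z))
      (df := fun z => (b z + a z * (e / 2)) * exp (- A z)); [|lra|].
    - apply is_derive_half_of_is_derive. intros x _.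
      pose proof (is_derive_unique _ _ _ (HA x)) as U1.
      pose proof (is_derive_unique _ _ _ (Hy x)) as U2.
      auto_derive.
      + repeat split; eexists; [exact (Hy x)|exact (HA x)].
      + change (Derive (fun x => A x) x) with (Derive A x).
        change (Derive (fun x => y x) x) with (Derive y x). rewrite U1, U2. ring.
    - intros x Hx. specialize (H1 x ltac:(lra)). specialize (H2 x ltac:(lra)).
      apply Rabs_def2 in H1. apply Rabs_def2 in H2.
      pose proof (exp_pos (- A x)).
      assert (b x + a x * (e / 2) <= 0) by nra. nra. }
  specialize (H3 z ltac:(lra)).
  rewrite Rminus_0_r, Rabs_right in H3 by apply Rgt_ge, exp_pos.
  pose proof (Rle_abs ((y (Z1 + Z2) - e / 2) * exp (- A (Z1 + Z2)))) as HM. fold C in HM.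
  assert (E : y z - e / 2 = (y z - e / 2) * exp (- A z) * exp (A z)).
  { rewrite Rmult_assoc, <- exp_plus, Rplus_opp_l, exp_0; ring. }
  pose proof (exp_pos (A z)).
  assert (exp (A z) * (C + 1) < e / 2).
  { apply Rmult_lt_reg_r with (/ (C + 1)); [apply Rinv_0_lt_compat; lra|].
    replace (exp (A z) * (C + 1) * / (C + 1)) with (exp (A z)) by (field; lra). exact H3. }
  assert (y z - e / 2 < e / 2) by (rewrite E; nra). lra.
Qed.

(** Variation of constants produces [y] with the prescribed initial value. Its decay follows from
    the one-sided bound applied to [y] and to [- y], which solves the same equation with forcing
    [- b]. *)
Lemma stable_ode (a b : R -> R) (l y0 : R) :
  (forall z, continuous a z) -> (forall z, continuous b z) ->
  tends_at_infty a l -> l < 0 -> tends_at_infty b 0 ->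
  exists y, y 0 = y0 /\ (forall z, is_derive y z (a z * y z + b z)) /\ tends_at_infty y 0.
Proof.
  intros Ha Hb Hl Hneg Hb0.
  destruct (primitive_of_continuous a Ha) as [A [A0 HA]].
  destruct (primitive_of_continuous (fun z => b z * exp (- A z))) as [J [J0 HJ]].
  { intros z. apply (continuous_mult b (fun z => exp (- A z))); [apply Hb|].
    apply (continuous_comp (fun z => - A z) exp).
    - apply (continuous_opp A). apply (ex_derive_continuous A). eexists; apply HA.
    - apply continuous_exp. }
  set (y := fun z => exp (A z) * (y0 + J z)).
  assert (Hy : forall z, is_derive y z (a z * y z + b z)).
  { intros z. unfold y.
    pose proof (is_derive_unique _ _ _ (HA z)) as U1.
    pose proof (is_derive_unique _ _ _ (HJ z)) as U2.
    auto_derive.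
    - repeat split; eexists; [exact (HA z)|exact (HJ z)].
    - change (Derive (fun x => A x) z) with (Derive A z).
      change (Derive (fun x => J x) z) with (Derive J z). rewrite U1, U2, exp_Ropp.
      field. apply Rgt_not_eq, exp_pos. }
  exists y. split; [|split; [exact Hy|]].
  - unfold y. rewrite A0, J0, exp_0; ring.
  - apply tends_real. intros e He.
    destruct (stable_ode_upper a b A y l HA Hl Hneg Hb0 Hy e He) as [Z1 [HZ1 H1]].
    destruct (stable_ode_upper a (fun z => - b z) A (fun z => - y z) l) with (e := e)
      as [Z2 [HZ2 H2]]; auto.
    + replace 0 with (- 0) by ring. apply (filterlim_comp _ _ _ b Ropp _ (locally 0)).
      * exact Hb0.
      * apply (filterlim_opp 0).
    + intros z. replace (a z * - y z + - b z) with (- (a z * y z + b z)) by ring.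
      apply (is_derive_opp y), Hy.
    + exists (Z1 + Z2). split; [lra|]. intros z Hz.
      specialize (H1 z ltac:(lra)). specialize (H2 z ltac:(lra)).
      apply Rabs_def1; lra.
Qed.

(** * First integrals and existence of half-line derivatives *)

(** The difference [f - k dg] is constant, so [dg] converges because [f] does. As [g] converges too,
    the limit of [dg] is 0, and the constant must be [l]. Each second-order equation, for the
    profile and for decaying perturbations, is integrated once in this way. *)
Lemma half_first_integral (g dg ddg f : R -> R) (k lg l : R) :
  0 < k -> is_derive_half g dg -> is_derive_half dg ddg ->
  is_derive_half f (fun z => k * ddg z) ->
  tends_at_infty g lg -> tends_at_infty f l ->
  forall z, 0 <= z -> k * dg z = f z - l.
Proof.
  intros Hk Hg Hdg Hf Hgl Hfl.
  assert (K : is_derive_half (fun z => f z + (- k) * dg z) (fun _ => 0)).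
  { eapply is_derive_half_ext; [| |
      exact (is_derive_half_plus _ _ _ _ Hf (is_derive_half_mult _ _ _ _ (is_derive_half_const (- k)) Hdg))].
    - intros; reflexivity.
    - intros z Hz; simpl; ring. }
  pose proof (half_derive_zero_const _ K) as E. simpl in E.
  set (c := f 0 + - k * dg 0) in *.
  assert (L : tends_at_infty dg ((l + - c) * / k)).
  { apply tends_ext with (fun z => (f z + - c) * / k).
    - intros z Hz. rewrite <- (E z Hz). field. lra.
    - apply tends_mult; [apply tends_plus; [exact Hfl|]|]; apply tends_const. }
  pose proof (tends_derive_zero _ _ _ _ Hg Hgl L) as Z.
  assert (l = c).
  { replace l with (c + (l + - c) * / k * k) by (field; lra). rewrite Z; ring. }
  intros z Hz. specialize (E z Hz). lra.
Qed.

(** The existential form allows the regularity of composite coefficients to be assembled without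
    writing out their derivatives. *)
Definition ex_derive_half (f : R -> R) : Prop := exists df, is_derive_half f df.

Lemma ex_derive_half_const (c : R) : ex_derive_half (fun _ => c).
Proof. eexists; apply is_derive_half_const. Qed.

Lemma ex_derive_half_plus (f g : R -> R) :
  ex_derive_half f -> ex_derive_half g -> ex_derive_half (fun z => f z + g z).
Proof. intros [df Hf] [dg Hg]; eexists; apply is_derive_half_plus; eassumption. Qed.

Lemma ex_derive_half_mult (f g : R -> R) :
  ex_derive_half f -> ex_derive_half g -> ex_derive_half (fun z => f z * g z).
Proof. intros [df Hf] [dg Hg]; eexists; apply is_derive_half_mult; eassumption. Qed.

Lemma ex_derive_half_inv (f : R -> R) :
  (forall z, 0 <= z -> f z <> 0) -> ex_derive_half f -> ex_derive_half (fun z => / f z).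
Proof. intros Hn [df Hf]; eexists; apply is_derive_half_inv; eassumption. Qed.

Lemma ex_derive_half_comp (F f : R -> R) :
  (forall z, 0 <= z -> ex_derive F (f z)) -> ex_derive_half f ->
  ex_derive_half (fun z => F (f z)).
Proof.
  intros HF [df Hf]; eexists; apply (is_derive_half_comp F (Derive F)); [|exact Hf].
  intros; apply Derive_correct; auto.
Qed.

Lemma ex_derive_half_continuous (f : R -> R) :
  ex_derive_half f -> forall z, continuous (fun z => f (Rmax 0 z)) z.
Proof. intros [df H]; eapply half_derive_continuous; exact H. Qed.

(** * Pressure, its difference quotient, and viscosities *)

Lemma smooth_pressure_ex_derive (P : R -> R) (r : R) :
  smooth_pressure P -> 0 < r -> ex_derive P r.
Proof. intros [H _] Hr. exact (H 1%nat r Hr). Qed.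

Lemma smooth_pressure_ex_derive2 (P : R -> R) (r : R) :
  smooth_pressure P -> 0 < r -> ex_derive (Derive P) r.
Proof. intros [H _] Hr. exact (H 2%nat r Hr). Qed.

(** At [rinf] this is the definition of the derivative of [P]; elsewhere [c2] coincides locally with
    a differentiable quotient. *)
Lemma c2_continuous (P : R -> R) (rinf r : R) :
  smooth_pressure P -> 0 < rinf -> 0 < r -> continuous (fun x => c2 P x rinf) r.
Proof.
  intros HP Hi Hr. destruct (Req_dec r rinf) as [->|N].
  - intros Q [e HQ]. unfold filtermap.
    pose proof (Derive_correct P rinf (smooth_pressure_ex_derive P rinf HP Hi)) as HD.
    apply is_derive_Reals in HD. destruct (HD e (cond_pos e)) as [d Hd].
    exists d. change (forall x : R, Rabs (x - rinf) < d -> Q (c2 P x rinf)). intros x Hx. apply HQ.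
    change (Rabs (c2 P x rinf - c2 P rinf rinf) < e).
    unfold c2. destruct (Req_EM_T rinf rinf) as [_|n]; [|contradiction].
    destruct (Req_EM_T x rinf) as [E|E].
    + rewrite Rminus_eq_0, Rabs_R0. apply cond_pos.
    + specialize (Hd (x - rinf)). replace (rinf + (x - rinf)) with (x : R) in Hd by (simpl; ring).
      apply Hd; [lra|exact Hx].
  - apply continuous_ext_loc with (fun x => (P x - P rinf) * / (x - rinf)).
    + exists (mkposreal (Rabs (r - rinf)) ltac:(apply Rabs_pos_lt; lra)).
      intros x Hx. change (Rabs (x - r) < Rabs (r - rinf)) in Hx.
      unfold c2. destruct (Req_EM_T x rinf) as [E|E]; [|intros; reflexivity].
      subst x. rewrite Rabs_minus_sym in Hx. lra.
    + apply (ex_derive_continuous (fun x => (P x - P rinf) * / (x - rinf))).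
      auto_derive. repeat split; [exact (smooth_pressure_ex_derive P r HP Hr)|lra].
Qed.

Lemma c2_spec (P : R -> R) (r rinf : R) : P r - P rinf = c2 P r rinf * (r - rinf).
Proof.
  unfold c2. destruct (Req_EM_T r rinf) as [->|N]; [ring|]. field. lra.
Qed.

Lemma c2_diag (P : R -> R) (r : R) : c2 P r r = Derive P r.
Proof. unfold c2. destruct (Req_EM_T r r); [intros; reflexivity|contradiction]. Qed.

Lemma eps_visc_pos (mu eta : R) : Rabs eta < mu -> 0 < mu /\ 0 < eps_visc mu eta.
Proof. intros H; apply Rabs_def2 in H; unfold eps_visc; lra. Qed.

(** * Integrated profile equations and rigidity of profiles *)

Lemma profile_mass (P : R -> R) (mu eta rinf uinf vinf : R) (w : layer R) :
  layer_profile P mu eta rinf uinf vinf w ->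
  forall z, 0 <= z -> rho w z * vy w z = rinf * vinf.
Proof.
  intros [_ [[drho [du [ddu [dv [ddv [df [dp [_ [_ [_ [_ [_ [H _]]]]]]]]]]]]] [Lr [_ Lv]]]].
  pose proof (half_derive_zero_const _ H) as E. simpl in E.
  assert (L : rho w 0 * vy w 0 = rinf * vinf).
  { apply (tends_unique (fun z => rho w z * vy w z)).
    - apply tends_ext with (fun _ => rho w 0 * vy w 0); [intros; symmetry; auto|].
      apply tends_const.
    - apply tends_mult; assumption. }
  intros z Hz; rewrite E; assumption.
Qed.

Lemma profile_vy_neq_0 (P : R -> R) (mu eta rinf uinf vinf : R) (w : layer R) :
  0 < rinf -> vinf <> 0 -> layer_profile P mu eta rinf uinf vinf w ->
  forall z, 0 <= z -> vy w z <> 0.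
Proof.
  intros Hr Hv Hw z Hz E. pose proof (profile_mass _ _ _ _ _ _ _ Hw z Hz) as M.
  rewrite E, Rmult_0_r in M. symmetry in M. apply Rmult_integral in M. lra.
Qed.

Lemma tends_pressure (P : R -> R) (f : R -> R) (r : R) :
  smooth_pressure P -> 0 < r -> tends_at_infty f r ->
  tends_at_infty (fun z => P (f z)) (P r).
Proof.
  intros HP Hr. apply (tends_comp (U := R_NormedModule) (V := R_NormedModule) P).
  apply (ex_derive_continuous P), smooth_pressure_ex_derive; assumption.
Qed.

Lemma tends_dpressure (P : R -> R) (f : R -> R) (r : R) :
  smooth_pressure P -> 0 < r -> tends_at_infty f r ->
  tends_at_infty (fun z => Derive P (f z)) (Derive P r).
Proof.
  intros HP Hr. apply (tends_comp (U := R_NormedModule) (V := R_NormedModule) (Derive P)).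
  apply (ex_derive_continuous (Derive P)), smooth_pressure_ex_derive2; assumption.
Qed.

(** One integration of the tangential momentum equation, followed by substitution of the constant
    mass flux. *)
Lemma profile_tangential_ode (P : R -> R) (mu eta rinf uinf vinf : R) (w : layer R) :
  0 < mu -> layer_profile P mu eta rinf uinf vinf w ->
  is_derive_half (vx w) (fun z => rinf * vinf / mu * (vx w z - uinf)).
Proof.
  intros Hmu Hw. pose proof (profile_mass _ _ _ _ _ _ _ Hw) as M.
  destruct Hw as [_ [[drho [du [ddu [dv [ddv [df [dp
    [_ [Hu [Hdu [_ [_ [_ [H _]]]]]]]]]]]]]] [Lr [Lu Lv]]]].
  assert (E : forall z, 0 <= z -> mu * du z = rho w z * vx w z * vy w z - rinf * uinf * vinf).
  { apply half_first_integral with (vx w) ddu uinf; try assumption.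
    repeat apply tends_mult; assumption. }
  apply is_derive_half_ext with (vx w) du; [intros; reflexivity| |exact Hu].
  intros z Hz. specialize (E z Hz). specialize (M z Hz).
  apply Rmult_eq_reg_l with mu; [|lra]. rewrite E.
  replace (rho w z * vx w z * vy w z) with (rho w z * vy w z * vx w z) by ring.
  rewrite M. field. lra.
Qed.

(** One integration of the normal momentum equation. The pressure difference is kept as it stands;
    it is factored through [c2] only where the profile is compared with its limit. *)
Lemma profile_normal_ode (P : R -> R) (mu eta rinf uinf vinf : R) (w : layer R) :
  smooth_pressure P -> 0 < eps_visc mu eta -> 0 < rinf ->
  layer_profile P mu eta rinf uinf vinf w ->
  is_derive_half (vy w) (fun z =>
    (rinf * vinf * (vy w z - vinf) + P (rho w z) - P rinf) / eps_visc mu eta).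
Proof.
  intros HP He Hr Hw. pose proof (profile_mass _ _ _ _ _ _ _ Hw) as M.
  destruct Hw as [_ [[drho [du [ddu [dv [ddv [df [dp
    [_ [_ [_ [Hv [Hdv [_ [_ [Hf [Hp HS]]]]]]]]]]]]]]]] [Lr [Lu Lv]]]].
  assert (E : forall z, 0 <= z -> eps_visc mu eta * dv z =
     (rho w z * vy w z ^ 2 + P (rho w z)) - (rinf * vinf ^ 2 + P rinf)).
  { apply half_first_integral with (vy w) ddv vinf; try assumption.
    - eapply is_derive_half_ext; [| |exact (is_derive_half_plus _ _ _ _ Hf Hp)];
        [intros; reflexivity|exact HS].
    - apply tends_plus; [apply tends_mult; [assumption|]|apply tends_pressure; assumption].
      simpl. repeat apply tends_mult; try assumption. apply tends_const. }
  apply is_derive_half_ext with (vy w) dv; [intros; reflexivity| |exact Hv].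
  intros z Hz. specialize (E z Hz). specialize (M z Hz).
  apply Rmult_eq_reg_l with (eps_visc mu eta); [|lra]. rewrite E.
  replace (rho w z * vy w z ^ 2) with (rho w z * vy w z * vy w z) by ring.
  rewrite M. field. lra.
Qed.

(** For inflow the rate [m / mu] is positive, so [U - uinf] solves a growing homogeneous equation
    and can tend to 0 only by vanishing. *)
Lemma profile_vx_const (P : R -> R) (mu eta rinf uinf vinf : R) (w : layer R) :
  0 < mu -> 0 < rinf -> 0 < vinf -> layer_profile P mu eta rinf uinf vinf w ->
  forall z, 0 <= z -> vx w z = uinf.
Proof.
  intros Hmu Hr Hv Hw z Hz.
  pose proof (profile_tangential_ode _ _ _ _ _ _ _ Hmu Hw) as H.
  destruct Hw as [_ [_ [_ [Lu _]]]].
  assert (Hm : 0 < rinf * vinf / mu) by (apply Rdiv_lt_0_compat; nra).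
  assert (E : vx w z + - uinf = 0); [|lra].
  apply (growing_ode_zero (fun _ => rinf * vinf / mu) (fun z => vx w z + - uinf) (rinf * vinf / mu));
    [intros; apply continuous_const| |apply tends_const|exact Hm| |exact Hz].
  - eapply is_derive_half_ext; [| |exact (is_derive_half_plus _ _ _ _ H (is_derive_half_const (- uinf)))].
    + intros; reflexivity.
    + intros x Hx; simpl; ring.
  - replace 0 with (uinf + - uinf) by ring. apply tends_plus; [exact Lu|].
    apply tends_const.
Qed.

(** Factored through [c2], the normal equation is linear homogeneous in [V - vinf], with a
    coefficient depending on the density. Its limit at infinity is positive in subsonic outflow,
    which forces [V - vinf = 0] whatever the amplitude. *)
Lemma profile_vy_const (P : R -> R) (mu eta rinf uinf vinf : R) (w : layer R) :
  smooth_pressure P -> 0 < eps_visc mu eta -> 0 < rinf -> vinf < 0 -> vinf ^ 2 < Derive P rinf ->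
  layer_profile P mu eta rinf uinf vinf w ->
  forall z, 0 <= z -> vy w z = vinf.
Proof.
  intros HP He Hr Hv Hs Hw z Hz.
  pose proof (profile_normal_ode _ _ _ _ _ _ _ HP He Hr Hw) as H.
  pose proof (profile_mass _ _ _ _ _ _ _ Hw) as M.
  destruct Hw as [Hpos [[drho [du [ddu [dv [ddv [df [dp [Hrho _]]]]]]]] [Lr [_ Lv]]]].
  set (a := fun r => (rinf * vinf + - (c2 P r rinf * r * / vinf)) * / eps_visc mu eta).
  assert (Ca : forall r, 0 < r -> continuous a r).
  { intros r Hr'. unfold a.
    apply (continuous_mult (fun r => rinf * vinf + - (c2 P r rinf * r * / vinf)) (fun _ => / eps_visc mu eta));
      [|apply continuous_const].
    apply (continuous_plus (fun _ => rinf * vinf) (fun r => - (c2 P r rinf * r * / vinf)));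
      [apply continuous_const|].
    apply (continuous_opp (fun r => c2 P r rinf * r * / vinf)).
    apply (continuous_mult (fun r => c2 P r rinf * r) (fun _ => / vinf)); [|apply continuous_const].
    apply (continuous_mult (fun r => c2 P r rinf) (fun r => r)); [|apply continuous_id].
    apply c2_continuous; assumption. }
  assert (E : vy w z + - vinf = 0); [|lra].
  apply (growing_ode_zero (fun z => a (rho w (Rmax 0 z))) (fun z => vy w z + - vinf) (a rinf));
    [| | | | |exact Hz].
  - intros x. apply (continuous_comp (fun z => rho w (Rmax 0 z)) a).
    + eapply half_derive_continuous; exact Hrho.
    + apply Ca, Hpos, Rmax_l.
  - eapply is_derive_half_ext; [| |exact (is_derive_half_plus _ _ _ _ H (is_derive_half_const (- vinf)))].
    + intros; reflexivity.
    + intros x Hx; simpl. rewrite Rmax_right by exact Hx. unfold a.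
      replace (rinf * vinf * (vy w x - vinf) + P (rho w x) - P rinf)
        with (rinf * vinf * (vy w x - vinf) + (P (rho w x) - P rinf)) by ring.
      rewrite (c2_spec P (rho w x) rinf), Rplus_0_r.
      (* Constancy of the mass flux converts the density difference into a multiple of the velocity
         difference. *)
      replace (rho w x - rinf) with (- (rho w x * / vinf * (vy w x - vinf)));
        [field; lra|].
      replace (rho w x * / vinf * (vy w x - vinf))
        with ((rho w x * vy w x) * / vinf - rho w x) by (field; lra).
      rewrite (M x Hx). field; lra.
  - apply tends_ext with (fun z => a (rho w z)); [intros x Hx; rewrite Rmax_right; auto|].
    apply (tends_comp (U := R_NormedModule) (V := R_NormedModule) a); [apply Ca, Hr|exact Lr].
  - unfold a. rewrite c2_diag.
    apply Rmult_lt_0_compat; [|apply Rinv_0_lt_compat, He].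
    replace (rinf * vinf + - (Derive P rinf * rinf * / vinf))
      with (rinf * (Derive P rinf - vinf ^ 2) * / - vinf) by (field; lra).
    apply Rmult_lt_0_compat; [apply Rmult_lt_0_compat; lra|apply Rinv_0_lt_compat; lra].
  - replace 0 with (vinf + - vinf) by ring. apply tends_plus; [exact Lv|].
    apply tends_const.
Qed.

(** * Linearized equations over the reals, and the linearized normal rate *)

(** The coefficients of the linearized system are real: real and imaginary parts of a complex
    solution solve it separately, and a real solution is also a complex one. All analysis is
    therefore done on this real version. *)
Definition real_linearized (P : R -> R) (mu eta : R) (w : layer R)
    (r u v : R -> R) : Prop :=
  exists dr du ddu dv ddv dflux dpress : R -> R,
    is_derive_half r dr /\
    is_derive_half u du /\ is_derive_half du ddu /\
    is_derive_half v dv /\ is_derive_half dv ddv /\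
    is_derive_half (fun z => r z * vy w z + rho w z * v z) (fun _ => 0) /\
    is_derive_half
      (fun z => r z * vx w z * vy w z + rho w z * u z * vy w z + rho w z * vx w z * v z)
      (fun z => mu * ddu z) /\
    is_derive_half
      (fun z => r z * (vy w z) ^ 2 + 2 * rho w z * vy w z * v z) dflux /\
    is_derive_half (fun z => Derive P (rho w z) * r z) dpress /\
    (forall z : R, 0 <= z -> dflux z + dpress z = eps_visc mu eta * ddv z).

Definition coordinate (p : C -> R) : Prop := p = fst \/ p = snd.

Lemma coordinate_linear (p : C -> R) :
  coordinate p -> is_linear (U := C_R_NormedModule) (V := R_NormedModule) p.
Proof.
  intros [->| ->]; [apply (is_linear_fst (U := R_NormedModule) (V := R_NormedModule))
                   |apply (is_linear_snd (U := R_NormedModule) (V := R_NormedModule))].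
Qed.

Lemma coordinate_0 (p : C -> R) : coordinate p -> p (RtoC 0) = 0.
Proof. intros [->| ->]; reflexivity. Qed.

Lemma real_linearized_coordinate (P : R -> R) (mu eta : R) (w : layer R) (d : layer C) (p : C -> R) :
  coordinate p -> linearized_equations P mu eta w d ->
  real_linearized P mu eta w (fun z => p (rho d z)) (fun z => p (vx d z)) (fun z => p (vy d z)).
Proof.
  intros Hp [ddr [du [ddu [dv [ddv [df [dp [H1 [H2 [H3 [H4 [H5 [H6 [H7 [H8 [H9 H10]]]]]]]]]]]]]]]].
  pose proof (coordinate_linear p Hp) as Lp.
  pose proof (fun f df => is_derive_half_linear (U := C_R_NormedModule) (V := R_NormedModule) p f df Lp) as K.
  exists (fun z => p (ddr z)), (fun z => p (du z)), (fun z => p (ddu z)), (fun z => p (dv z)),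
    (fun z => p (ddv z)), (fun z => p (df z)), (fun z => p (dp z)).
  do 5 (split; [apply K; assumption|]).
  split; [|split; [|split; [|split]]].
  - eapply is_derive_half_ext; [| |exact (K _ _ H6)]; intros z Hz;
      destruct Hp as [->| ->]; simpl; ring.
  - eapply is_derive_half_ext; [| |exact (K _ _ H7)]; intros z Hz;
      destruct Hp as [->| ->]; simpl; ring.
  - eapply is_derive_half_ext; [| |exact (K _ _ H8)]; intros z Hz;
      destruct Hp as [->| ->]; simpl; ring.
  - eapply is_derive_half_ext; [| |exact (K _ _ H9)]; intros z Hz;
      destruct Hp as [->| ->]; simpl; ring.
  - intros z Hz. generalize (f_equal p (H10 z Hz)).
    destruct Hp as [->| ->]; simpl; intros E; rewrite E; ring.
Qed.

Lemma is_linear_RtoC : is_linear (U := R_NormedModule) (V := C_R_NormedModule) RtoC.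
Proof.
  split.
  - intros x y. apply RtoC_plus.
  - intros k x. apply injective_projections; simpl;
      unfold scal; simpl; unfold mult; simpl; ring.
  - exists 2. split; [lra|]. intros x.
    unfold norm at 1; simpl. unfold prod_norm, norm; simpl. unfold abs; simpl.
    rewrite Rabs_R0. replace (Rabs x * (Rabs x * 1) + 0 * (0 * 1)) with (Rabs x ^ 2) by ring.
    rewrite sqrt_pow2 by apply Rabs_pos. pose proof (Rabs_pos x); lra.
Qed.

Lemma linearized_of_real (P : R -> R) (mu eta : R) (w : layer R) (r u v : R -> R) :
  real_linearized P mu eta w r u v ->
  linearized_equations P mu eta w
    (Layer (fun z => RtoC (r z)) (fun z => RtoC (u z)) (fun z => RtoC (v z))).
Proof.
  intros [ddr [du [ddu [dv [ddv [df [dp [H1 [H2 [H3 [H4 [H5 [H6 [H7 [H8 [H9 H10]]]]]]]]]]]]]]]].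
  pose proof (fun f df => is_derive_half_linear (U := R_NormedModule) (V := C_R_NormedModule) RtoC f df is_linear_RtoC) as K.
  exists (fun z => RtoC (ddr z)), (fun z => RtoC (du z)), (fun z => RtoC (ddu z)), (fun z => RtoC (dv z)),
    (fun z => RtoC (ddv z)), (fun z => RtoC (df z)), (fun z => RtoC (dp z)).
  do 5 (split; [apply K; assumption|]). simpl.
  split; [|split; [|split; [|split]]].
  - eapply is_derive_half_ext; [| |exact (K _ _ H6)]; intros z Hz;
      apply injective_projections; simpl; ring.
  - eapply is_derive_half_ext; [| |exact (K _ _ H7)]; intros z Hz;
      apply injective_projections; simpl; ring.
  - eapply is_derive_half_ext; [| |exact (K _ _ H8)]; intros z Hz;
      apply injective_projections; simpl; ring.
  - eapply is_derive_half_ext; [| |exact (K _ _ H9)]; intros z Hz;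
      apply injective_projections; simpl; ring.
  - intros z Hz. rewrite <- RtoC_plus, (H10 z Hz). apply RtoC_mult.
Qed.

(* The linearization of [v -> (m v + P (m / v)) / eps] at [v = vy w z], with [m = rho v]. *)
Definition linear_rate (P : R -> R) (mu eta rinf vinf : R) (w : layer R) (z : R) : R :=
  (rinf * vinf + - (Derive P (rho w z) * rho w z * / vy w z)) * / eps_visc mu eta.

Lemma ex_derive_half_profile (P : R -> R) (mu eta rinf uinf vinf : R) (w : layer R) :
  layer_profile P mu eta rinf uinf vinf w ->
  ex_derive_half (rho w) /\ ex_derive_half (vx w) /\ ex_derive_half (vy w).
Proof.
  intros [_ [[dr [du [ddu [dv [ddv [df [dp [H1 [H2 [_ [H3 _]]]]]]]]]]] _]].
  repeat split; eexists; eassumption.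
Qed.

Lemma ex_derive_half_dpressure (P : R -> R) (mu eta rinf uinf vinf : R) (w : layer R) :
  smooth_pressure P -> layer_profile P mu eta rinf uinf vinf w ->
  ex_derive_half (fun z => Derive P (rho w z)).
Proof.
  intros HP Hw. apply (ex_derive_half_comp (Derive P) (rho w));
    [|exact (proj1 (ex_derive_half_profile _ _ _ _ _ _ _ Hw))].
  intros z Hz. apply smooth_pressure_ex_derive2; [exact HP|apply Hw, Hz].
Qed.

Lemma ex_derive_half_linear_rate (P : R -> R) (mu eta rinf uinf vinf : R) (w : layer R) :
  smooth_pressure P -> 0 < rinf -> vinf <> 0 -> layer_profile P mu eta rinf uinf vinf w ->
  ex_derive_half (linear_rate P mu eta rinf vinf w).
Proof.
  intros HP Hr Hv Hw. pose proof (ex_derive_half_dpressure _ _ _ _ _ _ _ HP Hw) as DP.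
  pose proof (profile_vy_neq_0 _ _ _ _ _ _ _ Hr Hv Hw) as Hn.
  destruct (ex_derive_half_profile _ _ _ _ _ _ _ Hw) as [DR [DU DV]].
  unfold linear_rate.
  apply (ex_derive_half_mult _ (fun _ => / eps_visc mu eta)); [|apply ex_derive_half_const].
  apply (ex_derive_half_plus (fun _ => rinf * vinf)); [apply ex_derive_half_const|].
  destruct (ex_derive_half_mult _ _ (ex_derive_half_const (-1))
    (ex_derive_half_mult _ _ (ex_derive_half_mult _ _ DP DR) (ex_derive_half_inv _ Hn DV))) as [g Hg].
  exists g. eapply is_derive_half_ext; [| |exact Hg]; intros z Hz; [simpl; ring|intros; reflexivity].
Qed.

Lemma tends_linear_rate (P : R -> R) (mu eta rinf uinf vinf : R) (w : layer R) :
  smooth_pressure P -> 0 < rinf -> vinf <> 0 -> layer_profile P mu eta rinf uinf vinf w ->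
  tends_at_infty (linear_rate P mu eta rinf vinf w)
    ((rinf * vinf + - (Derive P rinf * rinf * / vinf)) * / eps_visc mu eta).
Proof.
  intros HP Hr Hv [_ [_ [Lr [_ Lv]]]]. unfold linear_rate.
  apply tends_mult; [|apply tends_const].
  apply tends_plus; [apply tends_const|].
  replace (- (Derive P rinf * rinf * / vinf)) with ((-1) * (Derive P rinf * rinf * / vinf)) by ring.
  eapply tends_ext; [|apply tends_mult; [apply tends_const|
    apply tends_mult; [apply tends_mult; [apply tends_dpressure; eassumption|exact Lr]|
      apply tends_inv; [exact Hv|exact Lv]]]].
  intros z Hz; simpl; ring.
Qed.

(** * Uniqueness of decaying perturbations *)

(** Decay makes the mass constant and both momentum constants zero. Then [u] and [v] each satisfy a
    homogeneous linear equation with zero initial value, and [r V = 0] with [V] nonzero finishes. *)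
Lemma real_decaying_zero (P : R -> R) (mu eta rinf uinf vinf : R) (w : layer R) (r u v : R -> R) :
  smooth_pressure P -> 0 < mu -> 0 < eps_visc mu eta -> 0 < rinf -> vinf <> 0 ->
  layer_profile P mu eta rinf uinf vinf w -> real_linearized P mu eta w r u v ->
  tends_at_infty r 0 -> tends_at_infty u 0 -> tends_at_infty v 0 ->
  u 0 = 0 -> v 0 = 0 ->
  forall z, 0 <= z -> r z = 0 /\ u z = 0 /\ v z = 0.
Proof.
  intros HP Hmu He Hr Hv Hw Hl Tr Tu Tv U0 V0.
  pose proof (profile_mass _ _ _ _ _ _ _ Hw) as M.
  pose proof (profile_vy_neq_0 _ _ _ _ _ _ _ Hr Hv Hw) as Hn.
  pose proof (ex_derive_half_linear_rate _ _ _ _ _ _ _ HP Hr Hv Hw) as Da.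
  destruct Hw as [Hpos [_ [Lr [Lu Lv]]]].
  destruct Hl as [ddr [du [ddu [dv [ddv [df [dp [H1 [H2 [H3 [H4 [H5 [H6 [H7 [H8 [H9 H10]]]]]]]]]]]]]]]].
  assert (K : forall z, 0 <= z -> r z * vy w z + rho w z * v z = 0).
  { pose proof (half_derive_zero_const _ H6) as E; simpl in E.
    assert (L : r 0 * vy w 0 + rho w 0 * v 0 = 0 * vinf + rinf * 0).
    { apply (tends_unique (fun z => r z * vy w z + rho w z * v z)).
      - apply tends_ext with (fun _ => r 0 * vy w 0 + rho w 0 * v 0); [intros; symmetry; auto|].
        apply tends_const.
      - apply tends_plus; apply tends_mult; assumption. }
    intros z Hz. rewrite E, L by exact Hz. ring. }
  assert (KU : forall z, 0 <= z -> u z = 0).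
  { apply (linear_ode_zero (fun _ => rinf * vinf / mu) u); [intros; apply continuous_const| |exact U0].
    apply is_derive_half_ext with u du; [intros; reflexivity| |exact H2].
    intros z Hz.
    (* The limit, which equals 0, is spelled out term by term so that the rules for sums and
       products apply directly. *)
    pose proof (half_first_integral u du ddu _ mu 0 (0 * uinf * vinf + rinf * 0 * vinf + rinf * uinf * 0)
      Hmu H2 H3 H7 Tu) as E.
    specialize (E ltac:(repeat (apply tends_plus || apply tends_mult); assumption) z Hz). simpl in E.
    apply Rmult_eq_reg_l with mu; [|lra]. rewrite E.
    replace (r z * vx w z * vy w z + rho w z * u z * vy w z + rho w z * vx w z * v z)
      with (vx w z * (r z * vy w z + rho w z * v z) + (rho w z * vy w z) * u z) by ring.
    rewrite (K z Hz), (M z Hz). field. lra. }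
  assert (KV : forall z, 0 <= z -> v z = 0).
  { apply (linear_ode_zero (fun z => linear_rate P mu eta rinf vinf w (Rmax 0 z)) v);
      [apply ex_derive_half_continuous, Da| |exact V0].
    apply is_derive_half_ext with v dv; [intros; reflexivity| |exact H4].
    intros z Hz. rewrite Rmax_right by exact Hz.
    assert (H11 : is_derive_half
      (fun z => (r z * vy w z ^ 2 + 2 * rho w z * vy w z * v z) + Derive P (rho w z) * r z)
      (fun z => eps_visc mu eta * ddv z)).
    { eapply is_derive_half_ext; [| |exact (is_derive_half_plus _ _ _ _ H8 H9)]; [intros; reflexivity|exact H10]. }
    (* The factor [vinf * (vinf * 1)] is the unfolded square that [simpl] leaves. *)
    pose proof (half_first_integral v dv ddv _ _ 0
      ((0 * (vinf * (vinf * 1)) + 2 * rinf * vinf * 0) + Derive P rinf * 0)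
      He H4 H5 H11 Tv) as E.
    specialize (E ltac:(simpl; repeat (apply tends_plus || apply tends_mult || apply tends_dpressure);
      try assumption; apply tends_const) z Hz). simpl in E.
    specialize (K z Hz). specialize (M z Hz). specialize (Hn z Hz).
    assert (Er : r z = - (rho w z * v z) / vy w z) by (apply Rmult_eq_reg_r with (vy w z); [field_simplify; lra|exact Hn]).
    apply Rmult_eq_reg_l with (eps_visc mu eta); [|lra]. rewrite E.
    unfold linear_rate. rewrite <- M, Er. field. split; lra. }
  intros z Hz. split; [|split; auto].
  specialize (K z Hz). rewrite (KV z Hz) in K.
  assert (r z * vy w z = 0) by lra. apply Rmult_integral in H. destruct H; [assumption|].
  exfalso; exact (Hn z Hz H).
Qed.

(** The real result applied to real and imaginary parts. Testing the two velocity components at 0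
    makes it serve both boundary operators. *)
Lemma decaying_zero (P : R -> R) (mu eta rinf uinf vinf : R) (w : layer R) (d : layer C) :
  smooth_pressure P -> 0 < mu -> 0 < eps_visc mu eta -> 0 < rinf -> vinf <> 0 ->
  layer_profile P mu eta rinf uinf vinf w -> decaying_space P mu eta w d ->
  vx d 0 = RtoC 0 -> vy d 0 = RtoC 0 ->
  forall z, 0 <= z -> rho d z = RtoC 0 /\ vx d z = RtoC 0 /\ vy d z = RtoC 0.
Proof.
  intros HP Hmu He Hr Hv Hw [Hl [Tr [Tu Tv]]] U0 V0 z Hz.
  assert (K : forall p, coordinate p -> p (rho d z) = 0 /\ p (vx d z) = 0 /\ p (vy d z) = 0).
  { intros p Hp. pose proof (coordinate_linear p Hp) as Lp.
    assert (T : forall f, tends_at_infty (V := C_R_NormedModule) f (RtoC 0) ->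
      tends_at_infty (V := R_NormedModule) (fun z => p (f z)) 0).
    { intros f Hf. rewrite <- (coordinate_0 p Hp).
      exact (tends_linear (U := C_R_NormedModule) (V := R_NormedModule) p f (RtoC 0) Lp Hf). }
    apply (real_decaying_zero P mu eta rinf uinf vinf w (fun z => p (rho d z))
       (fun z => p (vx d z)) (fun z => p (vy d z))); auto.
    - apply real_linearized_coordinate; assumption.
    - rewrite U0; apply coordinate_0, Hp.
    - rewrite V0; apply coordinate_0, Hp. }
  destruct (K fst (or_introl eq_refl)) as [A1 [A2 A3]].
  destruct (K snd (or_intror eq_refl)) as [B1 [B2 B3]].
  repeat split; apply injective_projections; assumption.
Qed.

(** * Construction of bounded perturbations *)

(* Solutions with mass perturbation [kappa = r V + R v] and normal integration constant [c]. *)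
Lemma bounded_solution (P : R -> R) (mu eta rinf uinf vinf : R) (w : layer R)
    (kappa c lu lv : R) (u du ddu v dv : R -> R) :
  smooth_pressure P -> 0 < eps_visc mu eta -> 0 < rinf -> vinf <> 0 ->
  layer_profile P mu eta rinf uinf vinf w ->
  is_derive_half u du -> is_derive_half du ddu ->
  is_derive_half (fun z => kappa * vx w z + rinf * vinf * u z) (fun z => mu * ddu z) ->
  is_derive_half v dv ->
  (forall z, 0 <= z -> dv z = linear_rate P mu eta rinf vinf w z * v z
     + (kappa * (vy w z + Derive P (rho w z) * / vy w z) + c) * / eps_visc mu eta) ->
  tends_at_infty u lu -> tends_at_infty v lv ->
  bounded_space P mu eta w
    (Layer (fun z => RtoC ((kappa - rho w z * v z) / vy w z)) (fun z => RtoC (u z))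
       (fun z => RtoC (v z))).
Proof.
  intros HP He Hr Hv Hw Hu Hdu Hmom Hdv Ev Tu Tv.
  pose proof (profile_mass _ _ _ _ _ _ _ Hw) as M.
  pose proof (profile_vy_neq_0 _ _ _ _ _ _ _ Hr Hv Hw) as Hn.
  pose proof (ex_derive_half_dpressure _ _ _ _ _ _ _ HP Hw) as DP.
  destruct (ex_derive_half_profile _ _ _ _ _ _ _ Hw) as [DR [DU DV]].
  destruct Hw as [Hpos [_ [Lr [Lu Lv]]]].
  set (r := fun z => (kappa - rho w z * v z) / vy w z).
  assert (Dv : ex_derive_half v) by (eexists; exact Hdv).
  assert (K : forall z, 0 <= z -> r z * vy w z + rho w z * v z = kappa).
  { intros z Hz. unfold r. field. exact (Hn z Hz). }
  assert (Dr : ex_derive_half r).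
  { destruct (ex_derive_half_mult _ _ (ex_derive_half_plus _ _ (ex_derive_half_const kappa)
      (ex_derive_half_mult _ _ (ex_derive_half_const (-1)) (ex_derive_half_mult _ _ DR Dv)))
      (ex_derive_half_inv _ Hn DV)) as [g Hg].
    exists g. eapply is_derive_half_ext; [| |exact Hg]; intros z Hz; unfold r; [simpl; unfold Rdiv; ring|intros; reflexivity]. }
  split.
  - apply (linearized_of_real P mu eta w r u v). destruct Dr as [dr Hdr].
    assert (Df : ex_derive_half (fun z => r z * vy w z ^ 2 + 2 * rho w z * vy w z * v z)).
    { exact (ex_derive_half_plus _ _
        (ex_derive_half_mult _ _ (ex_intro _ dr Hdr)
          (ex_derive_half_mult _ _ DV (ex_derive_half_mult _ _ DV (ex_derive_half_const 1))))
        (ex_derive_half_mult _ _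
          (ex_derive_half_mult _ _ (ex_derive_half_mult _ _ (ex_derive_half_const 2) DR) DV) Dv)). }
    destruct Df as [df Hdf].
    destruct (ex_derive_half_mult _ _ DP (ex_intro _ dr Hdr)) as [dp Hdp].
    (* The second derivative of [v] is defined by the differentiated normal equation. What has to be
       checked is that [dv] is the linearized normal flux plus [c], divided by the viscosity. *)
    exists dr, du, ddu, dv, (fun z => (df z + dp z) * / eps_visc mu eta), df, dp.
    split; [exact Hdr|]. split; [exact Hu|]. split; [exact Hdu|]. split; [exact Hdv|].
    split; [|split; [|split; [|split; [|split]]]].
    + eapply is_derive_half_ext; [| |exact (is_derive_half_mult _ _ _ _
        (is_derive_half_plus _ _ _ _ (is_derive_half_plus _ _ _ _ Hdf Hdp) (is_derive_half_const c))
        (is_derive_half_const (/ eps_visc mu eta)))].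
      * intros z Hz. simpl. rewrite (Ev z Hz). specialize (Hn z Hz).
        unfold linear_rate, r. rewrite <- (M z Hz). field. split; lra.
      * intros z Hz; simpl; ring.
    + eapply is_derive_half_ext; [| |exact (is_derive_half_const kappa)];
        [intros z Hz; symmetry; exact (K z Hz)|intros; reflexivity].
    + eapply is_derive_half_ext; [| |exact Hmom]; [|intros; reflexivity].
      intros z Hz; simpl. rewrite <- (K z Hz), <- (M z Hz). ring.
    + exact Hdf.
    + exact Hdp.
    + intros z Hz. field. lra.
  - assert (T : forall f l, tends_at_infty f l ->
      tends_at_infty (V := C_R_NormedModule) (fun z => RtoC (f z)) (RtoC l)).
    { intros f l. apply (tends_linear (U := R_NormedModule) (V := C_R_NormedModule) RtoC f l is_linear_RtoC). }
    exists (RtoC ((kappa + -1 * (rinf * lv)) * / vinf)), (RtoC lu), (RtoC lv).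
    split; [|split]; apply T; [|exact Tu|exact Tv].
    apply tends_ext with (fun z => (kappa + -1 * (rho w z * v z)) * / vy w z).
    { intros z Hz. unfold Rdiv; ring. }
    apply tends_mult; [|apply tends_inv; assumption].
    apply tends_plus; [apply tends_const|].
    apply tends_mult; [apply tends_const|].
    apply tends_mult; assumption.
Qed.

(** A negative limiting rate makes the normal equation stable, so both the initial value and the
    mass perturbation can be prescribed freely once the integration constant is adjusted. *)
Lemma bounded_normal_solution (P : R -> R) (mu eta rinf uinf vinf : R) (w : layer R)
    (kappa v0 : R) :
  smooth_pressure P -> 0 < eps_visc mu eta -> 0 < rinf -> vinf <> 0 ->
  rinf * vinf + - (Derive P rinf * rinf * / vinf) < 0 ->
  layer_profile P mu eta rinf uinf vinf w ->
  exists c v dv, v 0 = v0 /\ is_derive_half v dv /\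
    (forall z, 0 <= z -> dv z = linear_rate P mu eta rinf vinf w z * v z
     + (kappa * (vy w z + Derive P (rho w z) * / vy w z) + c) * / eps_visc mu eta) /\
    tends_at_infty v 0.
Proof.
  intros HP He Hr Hv Hs Hw.
  pose proof (profile_vy_neq_0 _ _ _ _ _ _ _ Hr Hv Hw) as Hn.
  pose proof (ex_derive_half_linear_rate _ _ _ _ _ _ _ HP Hr Hv Hw) as Da.
  pose proof (tends_linear_rate _ _ _ _ _ _ _ HP Hr Hv Hw) as Ta.
  pose proof (ex_derive_half_dpressure _ _ _ _ _ _ _ HP Hw) as DP.
  destruct (ex_derive_half_profile _ _ _ _ _ _ _ Hw) as [DR [DU DV]].
  (* This constant cancels the limit of the forcing created by [kappa], so that [b] tends to 0. *)
  set (c := - (kappa * (vinf + Derive P rinf * / vinf))).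
  set (a := linear_rate P mu eta rinf vinf w) in *.
  set (b := fun z => (kappa * (vy w z + Derive P (rho w z) * / vy w z) + c) * / eps_visc mu eta).
  assert (Db : ex_derive_half b).
  { exact (ex_derive_half_mult _ _ (ex_derive_half_plus _ _ (ex_derive_half_mult _ _ (ex_derive_half_const kappa)
      (ex_derive_half_plus _ _ DV (ex_derive_half_mult _ _ DP (ex_derive_half_inv _ Hn DV))))
      (ex_derive_half_const c)) (ex_derive_half_const (/ eps_visc mu eta))). }
  assert (Tb : tends_at_infty b 0).
  { destruct Hw as [_ [_ [Lr [_ Lv]]]].
    replace 0 with ((kappa * (vinf + Derive P rinf * / vinf) + c) * / eps_visc mu eta)
      by (unfold c; ring).
    unfold b.
    apply tends_mult; [|apply tends_const].
    apply tends_plus; [|apply tends_const].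
    apply tends_mult; [apply tends_const|].
    apply tends_plus; [exact Lv|].
    apply tends_mult; [apply tends_dpressure; assumption|apply tends_inv; assumption]. }
  destruct (stable_ode (fun z => a (Rmax 0 z)) (fun z => b (Rmax 0 z))
    ((rinf * vinf + - (Derive P rinf * rinf * / vinf)) * / eps_visc mu eta) v0)
    as [y [Y0 [HY TY]]].
  - apply ex_derive_half_continuous, Da.
  - apply ex_derive_half_continuous, Db.
  - eapply tends_ext; [|exact Ta]. intros z Hz; simpl; rewrite Rmax_right by exact Hz; reflexivity.
  - pose proof (Rinv_0_lt_compat _ He). nra.
  - eapply tends_ext; [|exact Tb]. intros z Hz; simpl; rewrite Rmax_right by exact Hz; reflexivity.
  - exists c, y, (fun z => a (Rmax 0 z) * y z + b (Rmax 0 z)).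
    split; [exact Y0|]. split; [apply is_derive_half_of_is_derive; intros; apply HY|].
    split; [|exact TY].
    intros z Hz. rewrite Rmax_right by exact Hz. reflexivity.
Qed.

(** * Rank from preimages of the standard basis *)

Lemma lin_comb_2 {V : ModuleSpace C_Ring} (a : nat -> C) (e : nat -> V) :
  lin_comb 2 a e = plus (scal (a 1%nat : C_Ring) (e 1%nat)) (scal (a 2%nat : C_Ring) (e 2%nat)).
Proof. unfold lin_comb. rewrite sum_n_Sm, sum_n_n by auto. reflexivity. Qed.

Lemma lin_comb_3 {V : ModuleSpace C_Ring} (a : nat -> C) (e : nat -> V) :
  lin_comb 3 a e = plus (lin_comb 2 a e) (scal (a 3%nat : C_Ring) (e 3%nat)).
Proof. unfold lin_comb. rewrite sum_n_Sm by auto. reflexivity. Qed.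

(** When the image contains the standard basis vectors, the coefficients of a combination are its
    coordinates, which gives independence and spanning at once. *)
Lemma has_rank_2 {E : Type} (S : E -> Prop) (G : E -> C2_space) (d1 d2 : E) :
  S d1 -> S d2 -> G d1 = (RtoC 1, RtoC 0) -> G d2 = (RtoC 0, RtoC 1) -> has_rank S G 2.
Proof.
  intros S1 S2 G1 G2.
  assert (L : forall a, lin_comb 2 a (fun i => G (match i with 1%nat => d1 | _ => d2 end))
    = ((a 1%nat, a 2%nat) : C2_space)).
  { intros a. rewrite lin_comb_2, G1, G2.
    apply injective_projections; apply injective_projections; simpl; ring. }
  (* The default branch also answers for indices outside 1 and 2, which never enter the sum. *)
  exists (fun i => match i with 1%nat => d1 | _ => d2 end).
  split; [|split].
  - intros [|[|i]] _; assumption.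
  - intros a Ha. rewrite L in Ha.
    pose proof (f_equal fst Ha) as A1. pose proof (f_equal snd Ha) as A2. simpl in A1, A2.
    intros [|[|[|i]]] Hi; [lia|exact A1|exact A2|lia].
  - intros x _. exists (fun i => match i with 1%nat => fst (G x) | _ => snd (G x) end).
    rewrite L. apply surjective_pairing.
Qed.

Lemma has_rank_3 {E : Type} (S : E -> Prop) (G : E -> C3_space) (d1 d2 d3 : E) :
  S d1 -> S d2 -> S d3 -> G d1 = (RtoC 1, RtoC 0, RtoC 0) ->
  G d2 = (RtoC 0, RtoC 1, RtoC 0) -> G d3 = (RtoC 0, RtoC 0, RtoC 1) -> has_rank S G 3.
Proof.
  intros S1 S2 S3 G1 G2 G3.
  assert (L : forall a,
    lin_comb 3 a (fun i => G (match i with 1%nat => d1 | 2%nat => d2 | _ => d3 end))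
    = ((a 1%nat, a 2%nat, a 3%nat) : C3_space)).
  { intros a. rewrite lin_comb_3, lin_comb_2, G1, G2, G3.
    repeat apply injective_projections; simpl; ring. }
  exists (fun i => match i with 1%nat => d1 | 2%nat => d2 | _ => d3 end).
  split; [|split].
  - intros [|[|[|i]]] _; assumption.
  - intros a Ha. rewrite L in Ha.
    pose proof (f_equal (fun x => fst (fst x)) Ha) as A1.
    pose proof (f_equal (fun x => snd (fst x)) Ha) as A2.
    pose proof (f_equal snd Ha) as A3. simpl in A1, A2, A3.
    intros [|[|[|[|i]]]] Hi; [lia|exact A1|exact A2|exact A3|lia].
  - intros x _. exists (fun i => match i with
      1%nat => fst (fst (G x)) | 2%nat => snd (fst (G x)) | _ => snd (G x) end).
    rewrite L. repeat apply injective_projections; reflexivity.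
Qed.

(** * Transversality for outflow and inflow *)

Lemma is_derive_half_exp (k : R) :
  is_derive_half (fun z => exp (k * z)) (fun z => k * exp (k * z)).
Proof. apply is_derive_half_of_is_derive; intros z _; auto_derive; [exact I|ring]. Qed.

(** The purely tangential mode [u = exp (m z / mu)] with [kappa = c = 0] and [v = 0]; it is bounded
    because the mass flux [m] is negative. *)
Lemma bounded_tangential_outflow (P : R -> R) (mu eta rinf uinf vinf : R) (w : layer R) :
  smooth_pressure P -> 0 < mu -> 0 < eps_visc mu eta -> 0 < rinf -> vinf < 0 ->
  layer_profile P mu eta rinf uinf vinf w ->
  exists d, bounded_space P mu eta w d /\ Gamma_outflow d = (RtoC 1, RtoC 0).
Proof.
  intros HP Hmu He Hr Hv Hw. set (k := rinf * vinf / mu).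
  assert (Hk : k < 0).
  { unfold k, Rdiv. pose proof (Rinv_0_lt_compat mu Hmu). assert (rinf * vinf < 0) by nra. nra. }
  eexists. split.
  - apply (bounded_solution P mu eta rinf uinf vinf w 0 0 0 0
      (fun z => exp (k * z)) (fun z => k * exp (k * z)) (fun z => 0 * exp (k * z) + k * (k * exp (k * z)))
      (fun _ => 0) (fun _ => 0) HP He Hr ltac:(lra) Hw).
    + apply is_derive_half_exp.
    + apply (is_derive_half_mult (fun _ => k)); [apply is_derive_half_const|apply is_derive_half_exp].
    + eapply is_derive_half_ext; [| |exact (is_derive_half_mult _ _ _ _
        (is_derive_half_const (rinf * vinf)) (is_derive_half_exp k))]; intros z Hz; simpl; [ring|].
      unfold k; field; lra.
    + apply is_derive_half_const.
    + intros z Hz; ring.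
    + apply (exp_primitive_decays (fun _ => k) (fun z => k * z) k);
        [intros z; auto_derive; [exact I|ring]|apply tends_const|exact Hk].
    + apply tends_const.
  - unfold Gamma_outflow; simpl. rewrite Rmult_0_r, exp_0. reflexivity.
Qed.

(** The tangential mode already supplies [(1, 0)], so outflow reduces to one bounded normal mode
    with [kappa = 0] and [u = 0]. The subsonic and supersonic cases differ only in where that mode
    comes from. *)
Lemma transversal_outflow_of_normal (P : R -> R) (mu eta rinf uinf vinf : R) (w : layer R)
    (c lv : R) (v dv : R -> R) :
  smooth_pressure P -> 0 < mu -> 0 < eps_visc mu eta -> 0 < rinf -> vinf < 0 ->
  layer_profile P mu eta rinf uinf vinf w ->
  v 0 = 1 -> is_derive_half v dv ->
  (forall z, 0 <= z -> dv z = linear_rate P mu eta rinf vinf w z * v z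
     + (0 * (vy w z + Derive P (rho w z) * / vy w z) + c) * / eps_visc mu eta) ->
  tends_at_infty v lv ->
  transversal_outflow P mu eta w.
Proof.
  intros HP Hmu He Hr Hv Hw V0 Hdv Ev Tv. split.
  - intros d Hd HG. unfold Gamma_outflow in HG.
    pose proof (f_equal fst HG) as G1. pose proof (f_equal snd HG) as G2.
    apply (decaying_zero P mu eta rinf uinf vinf w d); try assumption; lra.
  - destruct (bounded_tangential_outflow _ _ _ _ _ _ _ HP Hmu He Hr Hv Hw) as [d1 [S1 G1]].
    eapply has_rank_2; [exact S1| |exact G1|].
    + apply (bounded_solution P mu eta rinf uinf vinf w 0 c 0 lv (fun _ => 0) (fun _ => 0) (fun _ => 0)
        v dv HP He Hr ltac:(lra) Hw); try assumption; try apply is_derive_half_const.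
      * eapply is_derive_half_ext; [| |exact (is_derive_half_const 0)]; intros z Hz; simpl; ring.
      * apply tends_const.
    + unfold Gamma_outflow; simpl. rewrite V0. reflexivity.
Qed.

Lemma transversal_inflow_subsonic (P : R -> R) (mu eta rinf uinf vinf : R) (w : layer R) :
  smooth_pressure P -> 0 < mu -> 0 < eps_visc mu eta -> 0 < rinf -> 0 < vinf ->
  vinf ^ 2 < Derive P rinf -> layer_profile P mu eta rinf uinf vinf w ->
  transversal_inflow P mu eta w.
Proof.
  intros HP Hmu He Hr Hv Hs Hw. split.
  - intros d Hd HG. unfold Gamma_inflow in HG.
    pose proof (f_equal (fun x => snd (fst x)) HG) as G1. pose proof (f_equal snd HG) as G2.
    apply (decaying_zero P mu eta rinf uinf vinf w d); try assumption; lra.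
  - pose proof (profile_vy_neq_0 _ _ _ _ _ _ _ Hr (Rgt_not_eq _ _ Hv) Hw 0 (Rle_refl 0)) as Hn.
    pose proof (profile_vx_const _ _ _ _ _ _ _ Hmu Hr Hv Hw) as HU.
    assert (Hrate : rinf * vinf + - (Derive P rinf * rinf * / vinf) < 0).
    { replace (rinf * vinf + - (Derive P rinf * rinf * / vinf))
        with (- (rinf * (Derive P rinf - vinf ^ 2) * / vinf)) by (field; lra).
      apply Ropp_lt_gt_0_contravar.
      apply Rmult_lt_0_compat; [apply Rmult_lt_0_compat; lra|apply Rinv_0_lt_compat; lra]. }
    assert (K : forall r0 u0 v0 : R, exists d, bounded_space P mu eta w d /\
      Gamma_inflow d = (RtoC r0, RtoC u0, RtoC v0)).
    { intros r0 u0 v0. set (kappa := r0 * vy w 0 + rho w 0 * v0).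
      destruct (bounded_normal_solution P mu eta rinf uinf vinf w kappa v0 HP He Hr
        (Rgt_not_eq _ _ Hv) Hrate Hw) as [c [v [dv [V0 [Hdv [Ev Tv]]]]]].
      eexists. split.
      - apply (bounded_solution P mu eta rinf uinf vinf w kappa c u0 0
          (fun _ => u0) (fun _ => 0) (fun _ => 0) v dv HP He Hr (Rgt_not_eq _ _ Hv) Hw);
          try assumption; try apply is_derive_half_const; [|apply tends_const].
        (* Because [U] is constant for inflow, the flux [kappa U + m u] is constant when [u] is, so
           a constant [u] solves the tangential equation for every [kappa]. *)
        eapply is_derive_half_ext; [| |exact (is_derive_half_const (kappa * uinf + rinf * vinf * u0))];
          intros z Hz; simpl; [rewrite HU by exact Hz|]; ring.
      - unfold Gamma_inflow; simpl. rewrite V0.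
        replace ((kappa - rho w 0 * v0) / vy w 0) with r0 by (unfold kappa; field; exact Hn).
        reflexivity. }
    destruct (K 1 0 0) as [d1 [S1 G1]]. destruct (K 0 1 0) as [d2 [S2 G2]].
    destruct (K 0 0 1) as [d3 [S3 G3]].
    exact (has_rank_3 _ _ d1 d2 d3 S1 S2 S3 G1 G2 G3).
Qed.

Lemma sound_speed_sqr (P : R -> R) (r : R) :
  smooth_pressure P -> 0 < r -> 0 < sound_speed P r /\ sound_speed P r ^ 2 = Derive P r.
Proof.
  intros [_ HP] Hr. specialize (HP r Hr). unfold sound_speed. split.
  - apply sqrt_lt_R0, HP.
  - simpl. rewrite Rmult_1_r. apply sqrt_sqrt. lra.
Qed.

Theorem proposition5p5 (P : R -> R) (mu eta : R) (rinf uinf vinf : R)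
    (w : layer R)
    (hP : smooth_pressure P)
    (hmu : Rabs eta < mu)
    (hrinf : 0 < rinf)
    (hw : layer_profile P mu eta rinf uinf vinf w) :
  (* (a) *)
  (forall u0 v0 : R,
     vinf < 0 -> 0 < vinf + sound_speed P rinf ->
     vx w 0 = u0 -> vy w 0 = v0 -> v0 < 0 ->
     (forall z : R, 0 <= z -> vy w z = vinf) /\ vinf = v0 /\
     transversal_outflow P mu eta w) /\
  (* (b) *)
  (forall u0 v0 : R,
     vinf + sound_speed P rinf < 0 ->
     vx w 0 = u0 -> vy w 0 = v0 -> v0 < 0 ->
     rate_negative_between P rinf vinf v0 ->
     transversal_outflow P mu eta w) /\
  (* (c) *)
  (forall rho0 u0 v0 : R,
     0 < vinf -> vinf - sound_speed P rinf < 0 ->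
     rho w 0 = rho0 -> vx w 0 = u0 -> vy w 0 = v0 -> 0 < v0 ->
     rate_negative_between P rinf vinf v0 ->
     (forall z : R, 0 <= z -> vx w z = uinf) /\ uinf = u0 /\
     rinf * vinf = rho0 * v0 /\
     transversal_inflow P mu eta w).
Proof.
  destruct (eps_visc_pos mu eta hmu) as [Hmu He].
  destruct (sound_speed_sqr P rinf hP hrinf) as [Hc Hc2].
  split; [|split].
  - intros u0 v0 Hv Hsub _ HV0 _.
    assert (Hs : vinf ^ 2 < Derive P rinf) by (rewrite <- Hc2; nra).
    pose proof (profile_vy_const _ _ _ _ _ _ _ hP He hrinf Hv Hs hw) as HV.
    split; [exact HV|]. split; [rewrite <- HV0; symmetry; apply HV; lra|].
    assert (HR : forall z, 0 <= z -> rho w z = rinf).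
    { intros z Hz. pose proof (profile_mass _ _ _ _ _ _ _ hw z Hz) as M.
      rewrite (HV z Hz) in M. apply Rmult_eq_reg_r with vinf; lra. }
    (* With density and normal velocity constant, the linear rate is constant; the chosen [c]
       cancels it, making [v = 1] an exact bounded solution. *)
    apply (transversal_outflow_of_normal P mu eta rinf uinf vinf w
      (- (rinf * vinf + - (Derive P rinf * rinf * / vinf))) 1 (fun _ => 1) (fun _ => 0));
      try assumption; try reflexivity; [apply is_derive_half_const| |apply tends_const].
    intros z Hz. unfold linear_rate. rewrite (HR z Hz), (HV z Hz). ring.
  - intros u0 v0 Hsup _ _ _ _.
    assert (Hv : vinf < 0) by lra.
    assert (Hs : Derive P rinf < vinf ^ 2) by (rewrite <- Hc2; nra).
    destruct (bounded_normal_solution P mu eta rinf uinf vinf w 0 1 hP He hrinf)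
      as [c [v [dv [V0 [Hdv [Ev Tv]]]]]]; [lra| |exact hw|].
    (* Supersonic outflow gives a negative limiting rate, so the mode starting from 1 decays. *)
    { replace (rinf * vinf + - (Derive P rinf * rinf * / vinf))
        with (- (rinf * (vinf ^ 2 - Derive P rinf) * / - vinf)) by (field; lra).
      apply Ropp_lt_gt_0_contravar.
      apply Rmult_lt_0_compat; [apply Rmult_lt_0_compat; lra|apply Rinv_0_lt_compat; lra]. }
    exact (transversal_outflow_of_normal P mu eta rinf uinf vinf w c 0 v dv
      hP Hmu He hrinf Hv hw V0 Hdv Ev Tv).
  - intros rho0 u0 v0 Hv Hsub HR0 HU0 HV0 _ _.
    assert (Hs : vinf ^ 2 < Derive P rinf) by (rewrite <- Hc2; nra).
    pose proof (profile_vx_const _ _ _ _ _ _ _ Hmu hrinf Hv hw) as HU.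
    split; [exact HU|]. split; [rewrite <- HU0; symmetry; apply HU; lra|].
    split; [rewrite <- HR0, <- HV0; symmetry; apply (profile_mass _ _ _ _ _ _ _ hw); lra|].
    exact (transversal_inflow_subsonic P mu eta rinf uinf vinf w hP Hmu He hrinf Hv Hs hw).
Qed.
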